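(* Let $-1<p\leq 0$. Then, with $\alpha=0$ and $\beta=\frac{1}{8(p+1)(p+3)}$, the inequalities $$\frac{\left(\frac{p+2}{p+1}+\alpha x^2\right)\mathcal{I}_{p+1}(x)}{\frac{1}{p+1}+\mathcal{I}_p(x)+\alpha x^2}<1<\frac{\left(\frac{p+2}{p+1}+\beta x^2\right)\mathcal{I}_{p+1}(x)}{\frac{1}{p+1}+\mathcal{I}_p(x)+\beta x^2}$$ hold for all $x\in(0,\infty)$. Moreover these constants $\alpha$ and $\beta$ are best possible: the left-hand inequality fails for some $x\in(0,\infty)$ if $\alpha$ is replaced by any larger constant, and the right-hand inequality fails for some $x\in(0,\infty)$ if $\beta$ is replaced by any smaller constant.
   Context: For $q>-1$, $I_q(x)=\sum_{n\geq 0}\frac{(x/2)^{q+2n}}{n!\,\Gamma(q+n+1)}$ (for $x>0$) is the modified Bessel function of the first kind of order $q$. The normalized function $\mathcal{I}_q:\mathbb{R}\to[1,\infty)$ is defined by $$\mathcal{I}_q(x)=2^q\Gamma(q+1)x^{-q}I_q(x)=\sum_{n\geq 0}\frac{(1/4)^n}{(q+1)_n\, n!}x^{2n},$$ where $(q+1)_n=\Gamma(q+n+1)/\Gamma(q+1)$ is the Pochhammer symbol (the power series defines $\mathcal{I}_q$ for all real $x$, including $x=0$). *)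

(* Defs.v *)
From Stdlib Require Import Reals Factorial Lra.
From Coquelicot Require Import Coquelicot.
Open Scope R_scope.

(* Euler's integral; it converges for s > 0, the only range used here. *)
Definition Gamma (s : R) : R :=
  RInt_gen (fun t : R => Rpower t (s - 1) * exp (- t))
           (at_right 0) (Rbar_locally p_infty).

Definition pochhammer (a : R) (n : nat) : R := Gamma (a + INR n) / Gamma a.

(* Modified Bessel function of the first kind, for x > 0. *)
Definition besselI (q x : R) : R :=
  Series (fun n : nat =>
    Rpower (x / 2) (q + 2 * INR n) / (INR (fact n) * Gamma (q + INR n + 1))).

(* [2^q Gamma(q+1) x^(-q) I_q(x)] extended to all real x by its power series;
   see [nbesselI_besselI]. *)
Definition nbesselI (q x : R) : R :=
  Series (fun n : nat =>
    (1 / 4) ^ n / (pochhammer (q + 1) n * INR (fact n)) * x ^ (2 * n)).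

Lemma nbesselI_besselI (q x : R) :
  0 < x ->
  nbesselI q x = Rpower 2 q * Gamma (q + 1) * Rpower x (- q) * besselI q x.
Proof.
intros Hx. unfold nbesselI, besselI. rewrite <- Series_scal_l.
apply Series_ext; intros n. unfold pochhammer.
replace (q + 1 + INR n) with (q + INR n + 1) by ring.
assert (Hpow : Rpower 2 q * Rpower x (- q) * Rpower (x / 2) (q + 2 * INR n)
               = (1 / 4) ^ n * x ^ (2 * n)).
{ replace (1 / 4) with ((/ 2) ^ 2) by field.
  rewrite <- pow_mult, <- Rpow_mult_distr.
  replace (/ 2 * x) with (x / 2) by field.
  rewrite <- (Rpower_pow (2 * n) (x / 2)) by lra.
  rewrite mult_INR, Rpower_plus.
  assert (H2 : Rpower x q = Rpower 2 q * Rpower (x / 2) q).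
  { rewrite Rpower_mult_distr by lra. f_equal; field. }
  rewrite Rpower_Ropp.
  assert (Hq : Rpower x q <> 0) by (unfold Rpower; apply Rgt_not_eq, exp_pos).
  replace (INR 2) with 2 by reflexivity.
  transitivity (Rpower 2 q * Rpower (x / 2) q * / Rpower x q
                * Rpower (x / 2) (2 * INR n)); [ring|].
  rewrite <- H2, Rinv_r by exact Hq. ring. }
unfold Rdiv in *. rewrite !Rinv_mult, Rinv_inv.
transitivity ((1 * / 4) ^ n * x ^ (2 * n)
              * (Gamma (q + 1) * / Gamma (q + INR n + 1) * / INR (fact n)));
  [ring|].
rewrite <- Hpow. ring.
Qed.

Definition quot_den (p c x : R) : R := 1 / (p + 1) + nbesselI p x + c * x ^ 2.

Definition quot (p c x : R) : R :=
  ((p + 2) / (p + 1) + c * x ^ 2) * nbesselI (p + 1) x / quot_den p c x.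

(* Main.v *)
(** Put u = x^2/4.  Every coefficient of I_(p+1) is an explicit multiple of the one of I_p, because
    Gamma(s+1) = s Gamma(s).  Hence the numerator of [quot p c x] minus its denominator is u^2 E(u),
    where the coefficient of u^n in the entire function E has the sign of
    4c(p+1) - (n+1)/((n+2)(n+p+3)).
    For c = 0 these are all negative; for c = beta they are proportional to n(n-1-p), hence
    nonnegative when p <= 0.  For c > 0 they are eventually positive, so E > 0 somewhere far out,
    while for c < beta we have E(0) < 0, so E < 0 near the origin. *)
Require Import Defs.
From Stdlib Require Import Reals Factorial Lra Lia.
From Coquelicot Require Import Coquelicot.
Open Scope R_scope.

(** * Improper integrals of nonnegative functions *)

(** For nonnegative [f] the integral grows with the interval, so the supremum over compact
    subintervals of the half-line is the limit. *)
Lemma is_RInt_gen_pos_bounded (f : R -> R) (M : R) :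
  (forall t, 0 < t -> 0 <= f t) ->
  (forall t, 0 < t -> continuous f t) ->
  (forall a b, 0 < a -> a < b -> RInt f a b <= M) ->
  exists L, is_RInt_gen f (at_right 0) (Rbar_locally p_infty) L /\
    forall a b, 0 < a -> a < b -> RInt f a b <= L.
Proof.
intros Hpos Hcont HM.
assert (Hex : forall a b, 0 < a -> 0 < b -> ex_RInt f a b).
{ intros a b Ha Hb. apply (ex_RInt_continuous (V := R_CompleteNormedModule)).
  intros z [Hz _]. apply Hcont.
  apply Rlt_le_trans with (2 := Hz). now apply Rmin_glb_lt. }
set (E := fun y => exists a b, 0 < a /\ a < b /\ y = RInt f a b).
destruct (completeness E) as [L [HL1 HL2]].
{ exists M. intros y (a & b & Ha & Hab & ->). auto. }
{ exists (RInt f 1 2), 1, 2. repeat split; lra. }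
exists L. split.
2: { intros a b Ha Hab. apply HL1. exists a, b. auto. }
intros P [eps HP].
assert (He : exists a0 b0, 0 < a0 /\ a0 < b0 /\ L - eps < RInt f a0 b0).
{ apply Classical_Prop.NNPP. intros Hn.
  assert (L <= L - eps).
  { apply HL2. intros y (a & b & Ha & Hab & ->).
    apply Rnot_lt_le. intros Hlt. apply Hn. exists a, b. auto. }
  pose proof (cond_pos eps). lra. }
destruct He as (a0 & b0 & Ha0 & Hab0 & He).
apply (Filter_prod _ _ _ (fun a => 0 < a < a0) (fun b => b0 < b)).
- exists (mkposreal a0 Ha0). intros y Hy Hy0.
  unfold ball in Hy; simpl in Hy. unfold AbsRing_ball, abs, minus, plus, opp in Hy.
  simpl in Hy. rewrite Rabs_pos_eq in Hy; lra.
- exists b0. auto.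
- intros a b [Ha Haa] Hb. simpl.
  exists (RInt f a b). split.
  { apply (RInt_correct (V := R_CompleteNormedModule)). apply Hex; lra. }
  apply HP.
  assert (H1 : RInt f a b <= L) by (apply HL1; exists a, b; repeat split; lra).
  (* Widening [[a0, b0]] to [[a, b]] adds two nonnegative pieces, so the value stays within [eps] of
     the supremum. *)
  assert (H2 : RInt f a0 b0 <= RInt f a b).
  { rewrite <- (RInt_Chasles (V := R_CompleteNormedModule) f a a0 b) by (apply Hex; lra).
    rewrite <- (RInt_Chasles (V := R_CompleteNormedModule) f a0 b0 b) by (apply Hex; lra).
    unfold plus; simpl.
    assert (0 <= RInt f a a0) by (apply RInt_ge_0; [lra | apply Hex; lra | intros; apply Hpos; lra]).
    assert (0 <= RInt f b0 b) by (apply RInt_ge_0; [lra | apply Hex; lra | intros; apply Hpos; lra]).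
    lra. }
  unfold ball; simpl. unfold AbsRing_ball, abs, minus, plus, opp. simpl.
  apply Rabs_def1; pose proof (cond_pos eps); lra.
Qed.

(** * Euler's integral: convergence, positivity, functional equation *)

Definition gamma_integrand (s t : R) : R := Rpower t (s - 1) * exp (- t).

(** The boundary term of the integration by parts behind [Gamma_S]. *)
Definition gamma_boundary (s t : R) : R := Rpower t s * exp (- t).

Lemma gamma_integrand_S (s t : R) : gamma_integrand (s + 1) t = gamma_boundary s t.
Proof.
unfold gamma_integrand, gamma_boundary. now replace (s + 1 - 1) with s by ring.
Qed.

Lemma gamma_integrand_pos (s t : R) : 0 < gamma_integrand s t.
Proof.
unfold gamma_integrand, Rpower. apply Rmult_lt_0_compat; apply exp_pos.
Qed.

Lemma continuous_gamma_integrand (s t : R) : 0 < t -> continuous (gamma_integrand s) t.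
Proof.
intros Ht. apply (ex_derive_continuous (V := R_NormedModule)).
unfold gamma_integrand, Rpower. auto_derive. exact Ht.
Qed.

Lemma is_derive_gamma_boundary (s t : R) : 0 < t ->
  is_derive (gamma_boundary s) t (s * gamma_integrand s t - gamma_integrand (s + 1) t).
Proof.
intros Ht. rewrite gamma_integrand_S.
unfold gamma_boundary, gamma_integrand, Rminus at 2, Rpower at 1.
rewrite Rpower_plus, Rpower_Ropp, Rpower_1 by exact Ht.
auto_derive; [exact Ht|]. fold (Rpower t s). field. lra.
Qed.

Lemma exp_le (x y : R) : x <= y -> exp x <= exp y.
Proof.
intros [H | ->]; [left; now apply exp_increasing | apply Rle_refl].
Qed.

(** Half of the exponential absorbs the power: [ln y <= y] at [y = t / (2 * s)], multiplied by [s],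
    gives [s * ln t <= s * ln (2 * s) + t / 2]. *)
Lemma gamma_boundary_le (s t : R) : 0 < s -> 0 < t ->
  gamma_boundary s t <= Rpower (2 * s) s * exp (- (t / 2)).
Proof.
intros Hs Ht. unfold gamma_boundary, Rpower. rewrite <- !exp_plus.
apply exp_le.
assert (Hy : 0 < t / (2 * s)) by (apply Rdiv_lt_0_compat; lra).
assert (Hln : ln t = ln (2 * s) + ln (t / (2 * s))).
{ rewrite <- ln_mult by lra. f_equal. field. lra. }
assert (Hle : s * ln (t / (2 * s)) <= s * (t / (2 * s))).
{ apply Rmult_le_compat_l; [lra|].
  pose proof (exp_ineq1_le (ln (t / (2 * s)))) as H. rewrite exp_ln in H by exact Hy. lra. }
replace (s * (t / (2 * s))) with (t / 2) in Hle by (field; lra).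
rewrite Hln. lra.
Qed.

(* With G the boundary term, [s * f = G' + G] is at most [G' + C * exp (- t / 2)], whose primitive
   is bounded on the whole half-line. *)
Lemma RInt_gamma_integrand_le (s a b : R) : 0 < s -> 0 < a -> a < b ->
  RInt (gamma_integrand s) a b <= 3 * Rpower (2 * s) s / s.
Proof.
intros Hs Ha Hab.
set (C := Rpower (2 * s) s).
assert (HC : 0 < C) by apply exp_pos.
set (F := fun t => (gamma_boundary s t - 2 * C * exp (- (t / 2))) / s).
set (f := fun t => (s * gamma_integrand s t - gamma_integrand (s + 1) t
                    + C * exp (- (t / 2))) / s).
assert (HF : is_RInt f a b (F b - F a)).
{ apply (is_RInt_derive (V := R_CompleteNormedModule) F f).
  - intros t [Ht _]. rewrite Rmin_left in Ht by lra. unfold F, f, Rdiv.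
    evar_last.
    { apply (is_derive_scal_l (V := R_NormedModule)).
      apply (is_derive_minus (V := R_NormedModule)).
      - apply is_derive_gamma_boundary. lra.
      - instantiate (1 := - (C * exp (- (t / 2)))). auto_derive; [easy|]. unfold Rdiv; field. }
    unfold scal, minus, plus, opp; simpl. unfold mult; simpl. unfold Rdiv. ring.
  - intros t [Ht _]. rewrite Rmin_left in Ht by lra.
    apply (ex_derive_continuous (V := R_NormedModule)).
    unfold f, gamma_integrand, Rpower. auto_derive. repeat split; lra. }
apply Rle_trans with (RInt f a b).
- apply RInt_le; [lra | | now exists (F b - F a) |].
  + apply (ex_RInt_continuous (V := R_CompleteNormedModule)).
    intros t [Ht _]. rewrite Rmin_left in Ht by lra. apply continuous_gamma_integrand. lra.
  + intros t Ht. unfold f.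
    assert (Hb := gamma_boundary_le s t Hs ltac:(lra)). fold C in Hb.
    rewrite gamma_integrand_S.
    apply Rmult_le_reg_r with s; [lra|]. unfold Rdiv. rewrite Rmult_assoc, Rinv_l by lra. lra.
(* The factor 3 collects [gamma_boundary s b <= C] and [2 * C * exp (- (a / 2)) <= 2 * C]; the other
   two terms of [F b - F a] are negative. *)
- rewrite (is_RInt_unique _ _ _ _ HF). unfold F.
  assert (Hb := gamma_boundary_le s b Hs ltac:(lra)). fold C in Hb.
  assert (0 < gamma_boundary s a).
  { unfold gamma_boundary, Rpower. apply Rmult_lt_0_compat; apply exp_pos. }
  assert (He : forall t, 0 < t -> 0 < exp (- (t / 2)) <= 1).
  { intros t Ht. split; [apply exp_pos|]. rewrite <- exp_0. apply exp_le. lra. }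
  assert (H1 := He a Ha). assert (H2 := He b ltac:(lra)).
  unfold Rdiv. rewrite <- Rmult_minus_distr_r.
  apply Rmult_le_compat_r; [left; now apply Rinv_0_lt_compat|].
  nra.
Qed.

(** Positivity holds because the limit dominates the integral over [[1, 2]]. *)
Lemma Gamma_correct (s : R) : 0 < s ->
  is_RInt_gen (gamma_integrand s) (at_right 0) (Rbar_locally p_infty) (Gamma s) /\ 0 < Gamma s.
Proof.
intros Hs.
destruct (is_RInt_gen_pos_bounded (gamma_integrand s) (3 * Rpower (2 * s) s / s))
  as (L & HL & HLle).
- intros t _. left. apply gamma_integrand_pos.
- apply continuous_gamma_integrand.
- intros a b. now apply RInt_gamma_integrand_le.
- assert (HG : Gamma s = L).
  { exact (is_RInt_gen_unique (V := R_CompleteNormedModule) _ _ HL). }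
  rewrite HG. split; [exact HL|].
  apply Rlt_le_trans with (2 := HLle 1 2 ltac:(lra) ltac:(lra)).
  apply RInt_gt_0; [lra | intros; apply gamma_integrand_pos |].
  intros t Ht. apply continuous_gamma_integrand. lra.
Qed.

Lemma filterlim_gamma_boundary_0 (s : R) : 0 < s ->
  filterlim (gamma_boundary s) (at_right 0) (locally 0).
Proof.
intros Hs. apply filterlim_locally. intros eps.
(* At this radius [Rpower t s] reaches [eps]; the factor [exp (- t)] is at most 1. *)
exists (mkposreal (Rpower eps (/ s)) (exp_pos _)). intros t Ht Ht0.
unfold ball in *; simpl in *. unfold AbsRing_ball, abs, minus, plus, opp in *. simpl in *.
rewrite Rabs_pos_eq in Ht by lra.
assert (H : Rpower t s < eps).
{ replace (pos eps) with (Rpower (Rpower eps (/ s)) s).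
  - unfold Rpower at 1 2. apply exp_increasing. apply Rmult_lt_compat_l; [lra|].
    apply ln_increasing; lra.
  - rewrite Rpower_mult, Rinv_l by lra. apply Rpower_1, cond_pos. }
assert (exp (- t) <= 1) by (rewrite <- exp_0; apply exp_le; lra).
pose proof (exp_pos (- t)). assert (0 < Rpower t s) by apply exp_pos.
unfold gamma_boundary. apply Rabs_def1; nra.
Qed.

Lemma filterlim_gamma_boundary_p_infty (s : R) : 0 < s ->
  filterlim (gamma_boundary s) (Rbar_locally p_infty) (locally 0).
Proof.
intros Hs. apply filterlim_locally. intros eps.
set (C := Rpower (2 * s) s).
assert (HC : 0 < C) by apply exp_pos.
assert (Heps := cond_pos eps).
assert (HC2 : 0 < 2 * C / eps) by (apply Rdiv_lt_0_compat; lra).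
(* The threshold comes from [exp (t / 2) > t / 2], which puts [C * exp (- (t / 2))] below
   [2 * C / t]. *)
exists (2 * C / eps). intros t Ht.
assert (Hb := gamma_boundary_le s t Hs ltac:(lra)). fold C in Hb.
assert (0 < gamma_boundary s t).
{ unfold gamma_boundary, Rpower. apply Rmult_lt_0_compat; apply exp_pos. }
assert (He : C * exp (- (t / 2)) < eps).
{ rewrite exp_Ropp.
  pose proof (exp_ineq1_le (t / 2)). pose proof (exp_pos (t / 2)).
  apply Rmult_lt_reg_r with (exp (t / 2)); [lra|].
  rewrite Rmult_assoc, Rinv_l by lra.
  assert (C < eps * (t / 2)).
  { apply Rmult_lt_reg_l with (2 / eps); [apply Rdiv_lt_0_compat; lra|].
    replace (2 / eps * (eps * (t / 2))) with t by (field; lra).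
    replace (2 / eps * C) with (2 * C / eps) by (field; lra). exact Ht. }
  nra. }
unfold ball; simpl. unfold AbsRing_ball, abs, minus, plus, opp. simpl.
apply Rabs_def1; lra.
Qed.

(** Integration by parts: [gamma_boundary s] tends to 0 at both ends, so its derivative integrates
    to 0. *)
Lemma Gamma_S (s : R) : 0 < s -> Gamma (s + 1) = s * Gamma s.
Proof.
intros Hs.
destruct (Gamma_correct s Hs) as [H1 _].
destruct (Gamma_correct (s + 1) ltac:(lra)) as [H2 _].
assert (H3 : is_RInt_gen (fun t => s * gamma_integrand s t - gamma_integrand (s + 1) t)
               (at_right 0) (Rbar_locally p_infty) (0 - 0)).
{ assert (Hd : filter_prod (at_right 0) (Rbar_locally p_infty)
     (fun ab => forall x, Rmin (fst ab) (snd ab) <= x <= Rmax (fst ab) (snd ab) -> 0 < x)).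
  { apply (Filter_prod _ _ _ (fun a => 0 < a) (fun b => 0 < b)).
    - exists (mkposreal 1 Rlt_0_1). auto.
    - now exists 0.
    - intros a b Ha Hb x [Hx _]. apply Rlt_le_trans with (2 := Hx).
      now apply Rmin_glb_lt. }
  apply is_RInt_gen_ext with (f := Derive (gamma_boundary s)).
  { apply filter_imp with (2 := Hd). intros ab H x Hx.
    apply is_derive_unique, is_derive_gamma_boundary, H. lra. }
  apply is_RInt_gen_Derive.
  - apply filter_imp with (2 := Hd). intros ab H x Hx.
    eexists. apply is_derive_gamma_boundary. now apply H.
  - apply filter_imp with (2 := Hd). intros ab H x Hx.
    assert (Hx0 : 0 < x) by now apply H.
    apply continuous_ext_loc
      with (fun t => s * gamma_integrand s t - gamma_integrand (s + 1) t).
    (* Radius [x] keeps the ball inside the positive reals, where the formula for the derivative is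
       available. *)
    + exists (mkposreal x Hx0). intros y Hy. symmetry.
      apply is_derive_unique, is_derive_gamma_boundary.
      unfold ball in Hy; simpl in Hy. unfold AbsRing_ball, abs, minus, plus, opp in Hy.
      simpl in Hy. apply Rabs_def2 in Hy. lra.
    + apply (ex_derive_continuous (V := R_NormedModule)).
      unfold gamma_integrand, Rpower. auto_derive. repeat split; lra.
  - now apply filterlim_gamma_boundary_0.
  - now apply filterlim_gamma_boundary_p_infty. }
assert (H4 := is_RInt_gen_plus _ _ _ _ H3 H2).
assert (H5 := is_RInt_gen_scal _ s _ H1).
apply (is_RInt_gen_ext _ (fun t => scal s (gamma_integrand s t))) in H4.
- apply (is_RInt_gen_unique (V := R_CompleteNormedModule)) in H4.
  apply (is_RInt_gen_unique (V := R_CompleteNormedModule)) in H5.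
  assert (H6 := eq_trans (eq_sym H4) H5).
  unfold plus, scal in H6; simpl in H6. unfold mult in H6; simpl in H6. lra.
- apply filter_forall. intros ab x _. unfold plus, scal; simpl. unfold mult; simpl. ring.
Qed.

(** * Pochhammer symbols and Bessel coefficients *)

Lemma pochhammer_0 (a : R) : 0 < a -> pochhammer a 0 = 1.
Proof.
intros Ha. unfold pochhammer. simpl INR. rewrite Rplus_0_r.
destruct (Gamma_correct a Ha) as [_ H]. field. lra.
Qed.

Lemma pochhammer_S (a : R) (n : nat) : 0 < a ->
  pochhammer a (S n) = (a + INR n) * pochhammer a n.
Proof.
intros Ha. pose proof (pos_INR n). unfold pochhammer.
rewrite S_INR, <- Rplus_assoc, Gamma_S by lra. unfold Rdiv. ring.
Qed.

Lemma pochhammer_pos (a : R) (n : nat) : 0 < a -> 0 < pochhammer a n.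
Proof.
intros Ha. pose proof (pos_INR n).
apply Rdiv_lt_0_compat; apply Gamma_correct; lra.
Qed.

(** Coefficients in the variable [x ^ 2 / 4], which absorbs the powers of [1 / 4]. *)
Definition bessel_coef (q : R) (n : nat) : R :=
  1 / (pochhammer (q + 1) n * INR (fact n)).

Lemma bessel_coef_0 (q : R) : -1 < q -> bessel_coef q 0 = 1.
Proof.
intros Hq. unfold bessel_coef. rewrite pochhammer_0 by lra. simpl. field.
Qed.

Lemma bessel_coef_pos (q : R) (n : nat) : -1 < q -> 0 < bessel_coef q n.
Proof.
intros Hq. apply Rdiv_lt_0_compat; [lra|].
apply Rmult_lt_0_compat; [apply pochhammer_pos; lra | apply INR_fact_lt_0].
Qed.

Lemma bessel_coef_S (q : R) (n : nat) : -1 < q ->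
  bessel_coef q (S n) = bessel_coef q n / ((q + 1 + INR n) * (INR n + 1)).
Proof.
intros Hq. pose proof (pos_INR n). pose proof (INR_fact_lt_0 n).
pose proof (pochhammer_pos (q + 1) n ltac:(lra)).
unfold bessel_coef. rewrite pochhammer_S, fact_simpl, mult_INR, S_INR by lra.
field. lra.
Qed.

(** The products [(q+1)...(q+n)] and [(q+2)...(q+n+1)] share all but one factor each. *)
Lemma bessel_coef_shift (q : R) (n : nat) : -1 < q ->
  bessel_coef (q + 1) n = (q + 1) / (q + 1 + INR n) * bessel_coef q n.
Proof.
intros Hq. induction n as [|n IH].
- rewrite !bessel_coef_0 by lra. simpl. field. lra.
- pose proof (pos_INR n).
  rewrite !bessel_coef_S, IH, S_INR by lra. field. lra.
Qed.

Lemma CV_radius_bessel_coef (q : R) : -1 < q -> CV_radius (bessel_coef q) = p_infty.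
Proof.
intros Hq. apply CV_radius_infinite_DAlembert.
- intros n. apply Rgt_not_eq, bessel_coef_pos, Hq.
- apply is_lim_seq_le_le with (u := fun _ => 0) (w := fun n => / (q + 1) * / (INR (S n))).
  + intros n. pose proof (pos_INR n). pose proof (bessel_coef_pos q n Hq).
    replace (bessel_coef q (S n) / bessel_coef q n) with (/ (q + 1 + INR n) * / INR (S n))
      by (rewrite bessel_coef_S, S_INR by exact Hq; field; lra).
    rewrite S_INR.
    assert (0 < / (q + 1 + INR n)) by (apply Rinv_0_lt_compat; lra).
    assert (0 < / (INR n + 1)) by (apply Rinv_0_lt_compat; lra).
    rewrite Rabs_pos_eq by nra. split; [nra|].
    apply Rmult_le_compat_r; [lra|]. apply Rinv_le_contravar; lra.
  + apply is_lim_seq_const.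
  + evar_last.
    * apply is_lim_seq_scal_l. apply is_lim_seq_inv.
      -- apply (is_lim_seq_incr_1 INR). apply is_lim_seq_INR.
      -- discriminate.
    * simpl. f_equal. ring.
Qed.

(** * Everywhere convergent power series and their signs *)

Lemma ex_pseries_infinite (a : nat -> R) (u : R) :
  CV_radius a = p_infty -> ex_pseries a u.
Proof.
intros Ha. apply CV_radius_inside. rewrite Ha. exact I.
Qed.

Lemma nbesselI_PSeries (q x : R) : nbesselI q x = PSeries (bessel_coef q) (x ^ 2 / 4).
Proof.
apply Series_ext. intros n. unfold bessel_coef.
replace (x ^ 2 / 4) with (1 / 4 * x ^ 2) by field.
rewrite Rpow_mult_distr, <- pow_mult. unfold Rdiv. ring.
Qed.

Lemma PSeries_ge_0 (a : nat -> R) (u : R) :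
  (forall n, 0 <= a n) -> 0 <= u -> ex_pseries a u -> 0 <= PSeries a u.
Proof.
intros Ha Hu Hex. rewrite <- (PSeries_const_0 u).
apply Series_le.
- intros n. pose proof (pow_le u n Hu). pose proof (Ha n). split; nra.
- now apply ex_pseries_R.
Qed.

(** Splitting off the constant term and factoring out [u] lowers [k] by one and keeps the
    coefficients nonnegative. *)
Lemma PSeries_ge_term (a : nat -> R) (k : nat) (u : R) :
  (forall n, 0 <= a n) -> 0 <= u -> CV_radius a = p_infty -> a k * u ^ k <= PSeries a u.
Proof.
intros Ha Hu; revert a Ha. induction k as [|k IH]; intros a Ha Hr;
  rewrite PSeries_decr_1 by now apply ex_pseries_infinite.
- assert (0 <= PSeries (PS_decr_1 a) u).
  { apply PSeries_ge_0; [intros; apply Ha | exact Hu |].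
    apply ex_pseries_infinite. now rewrite CV_radius_decr_1. }
  simpl. nra.
- assert (H := IH (PS_decr_1 a) ltac:(intros; apply Ha) ltac:(now rewrite CV_radius_decr_1)).
  unfold PS_decr_1 at 1 in H. pose proof (Ha 0%nat). simpl. nra.
Qed.

Lemma CV_radius_decr_n (a : nat -> R) (n : nat) : CV_radius (PS_decr_n a n) = CV_radius a.
Proof.
revert a. induction n as [|n IH]; intros a; [reflexivity|].
rewrite <- (CV_radius_decr_1 a), <- (IH (PS_decr_1 a)). reflexivity.
Qed.

(** For [u >= 1] the terms up to degree [N] sum to at least [- K * u ^ N], with [K] the sum of their
    absolute coefficients; the term of degree [N + 1] alone outweighs this once
    [u * a (S N) > K]. *)
Lemma PSeries_eventually_pos (a : nat -> R) (N : nat) :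
  (forall n, (N <= n)%nat -> 0 < a n) -> CV_radius a = p_infty ->
  exists u, 0 < u /\ 0 < PSeries a u.
Proof.
intros Ha Hr.
set (K := sum_f_R0 (fun k => Rabs (a k)) N).
assert (HK : 0 <= K) by (apply cond_pos_sum; intros; apply Rabs_pos).
assert (HN := Ha (S N) ltac:(lia)).
assert (Hu : 1 <= K / a (S N) + 1).
{ assert (0 <= K / a (S N)) by (apply Rdiv_le_0_compat; assumption). lra. }
assert (HuK : K < (K / a (S N) + 1) * a (S N)).
{ replace ((K / a (S N) + 1) * a (S N)) with (K + a (S N)) by (field; lra). lra. }
set (u := K / a (S N) + 1) in *. clearbody u.
exists u. split; [lra|].
rewrite (PSeries_decr_n a N) by now apply ex_pseries_infinite.
assert (H1 : a (S N) <= PSeries (PS_decr_n a (S N)) u).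
{ rewrite <- (Rmult_1_r (a (S N))).
  replace (a (S N)) with (PS_decr_n a (S N) 0) by (unfold PS_decr_n; f_equal; lia).
  apply (PSeries_ge_term _ 0).
  - intros n. left. apply Ha. lia.
  - lra.
  - now rewrite CV_radius_decr_n. }
assert (H2 : - (K * u ^ N) <= sum_f_R0 (fun k => a k * u ^ k) N).
{ unfold K. rewrite Rmult_comm, scal_sum, <- (Rmult_1_l (sum_f_R0 _ _)), <- Ropp_mult_distr_l_reverse.
  rewrite scal_sum. apply sum_Rle. intros k Hk.
  assert (u ^ k <= u ^ N) by (apply Rle_pow; [exact Hu | lia]).
  assert (0 < u ^ k) by (apply pow_lt; lra).
  pose proof (Rabs_pos (a k)). pose proof (Rle_abs (- a k)). rewrite Rabs_Ropp in *.
  nra. }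
assert (0 < u ^ N) by (apply pow_lt; lra).
assert (H3 : u ^ N * (u * a (S N)) <= u ^ S N * PSeries (PS_decr_n a (S N)) u).
{ simpl. rewrite (Rmult_comm u (u ^ N)), Rmult_assoc.
  repeat (apply Rmult_le_compat_l; [lra|]). exact H1. }
assert (0 < u ^ N * (u * a (S N) - K)) by (apply Rmult_lt_0_compat; lra).
lra.
Qed.

(** * The gap between numerator and denominator as a power series *)

(* Coefficient of [u ^ (n + 2)], [u = x ^ 2 / 4], in the numerator of [quot p c x] minus its
   denominator; those of [1] and [u] vanish. *)
Definition gap_coef (p c : R) (n : nat) : R :=
  (p + 2) / (p + 1) * bessel_coef (p + 1) (S (S n)) - bessel_coef p (S (S n))
  + 4 * c * bessel_coef (p + 1) (S n).

(** The factor in front is positive, so the bracket, increasing in [c], carries the sign. *)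
Lemma gap_coef_eq (p c : R) (n : nat) : -1 < p ->
  gap_coef p c n = bessel_coef p (S n) / (p + 2 + INR n)
    * (4 * c * (p + 1) - (INR n + 1) / ((INR n + 2) * (p + 3 + INR n))).
Proof.
intros Hp. pose proof (pos_INR n). unfold gap_coef.
rewrite !bessel_coef_shift, (bessel_coef_S p (S n)), !S_INR by lra.
field. lra.
Qed.

(** This form lets the sum, scaling and shift rules for power series apply. *)
Lemma gap_coef_PS (p c : R) (n : nat) :
  gap_coef p c n = PS_plus (PS_plus
      (PS_scal ((p + 2) / (p + 1)) (PS_decr_1 (PS_decr_1 (bessel_coef (p + 1)))))
      (PS_scal (-1) (PS_decr_1 (PS_decr_1 (bessel_coef p)))))
      (PS_scal (4 * c) (PS_decr_1 (bessel_coef (p + 1)))) n.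
Proof.
unfold gap_coef, PS_plus, PS_scal, PS_decr_1, plus, scal; simpl. unfold mult; simpl. ring.
Qed.

Lemma ex_pseries_gap_parts (p u : R) : -1 < p ->
  ex_pseries (bessel_coef p) u /\ ex_pseries (PS_decr_1 (bessel_coef p)) u /\
  ex_pseries (PS_decr_1 (PS_decr_1 (bessel_coef p))) u.
Proof.
intros Hp. repeat split; apply ex_pseries_infinite;
  rewrite ?CV_radius_decr_1; now apply CV_radius_bessel_coef.
Qed.

(** Beyond a finite radius the terms would not tend to 0, against convergence there. *)
Lemma CV_radius_everywhere (a : nat -> R) :
  (forall u, ex_pseries a u) -> CV_radius a = p_infty.
Proof.
intros Ha. pose proof (CV_radius_ge_0 a) as H0.
case_eq (CV_radius a); [intros r Hr | easy | intros Hr].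
- exfalso. apply (CV_disk_outside a (Rabs r + 1)).
  + rewrite Hr. simpl. pose proof (Rle_abs r). pose proof (Rabs_pos r).
    rewrite Rabs_pos_eq; lra.
  + apply ex_series_lim_0. now apply ex_pseries_R.
- now rewrite Hr in H0.
Qed.

Lemma ex_pseries_scal_R (k : R) (a : nat -> R) (u : R) :
  ex_pseries a u -> ex_pseries (PS_scal k a) u.
Proof.
apply ex_pseries_scal. apply Rmult_comm.
Qed.

Lemma CV_radius_gap_coef (p c : R) : -1 < p -> CV_radius (gap_coef p c) = p_infty.
Proof.
intros Hp.
apply CV_radius_everywhere. intros u. eapply ex_pseries_ext; [intros n; symmetry; apply gap_coef_PS|].
destruct (ex_pseries_gap_parts p u Hp) as (_ & _ & H1).
destruct (ex_pseries_gap_parts (p + 1) u ltac:(lra)) as (_ & H2 & H3).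
repeat apply ex_pseries_plus; now apply ex_pseries_scal_R.
Qed.

Lemma quot_gap (p c x : R) : -1 < p ->
  ((p + 2) / (p + 1) + c * x ^ 2) * nbesselI (p + 1) x - quot_den p c x
  = (x ^ 2 / 4) ^ 2 * PSeries (gap_coef p c) (x ^ 2 / 4).
Proof.
intros Hp. unfold quot_den. rewrite !nbesselI_PSeries.
set (u := x ^ 2 / 4). replace (x ^ 2) with (4 * u) by (unfold u; field).
destruct (ex_pseries_gap_parts p u Hp) as (H0 & H1 & H2).
destruct (ex_pseries_gap_parts (p + 1) u ltac:(lra)) as (K0 & K1 & K2).
rewrite (PSeries_ext _ _ _ (gap_coef_PS p c)).
rewrite !PSeries_plus, !PSeries_scal
  by (repeat apply ex_pseries_plus; now apply ex_pseries_scal_R).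
(* Two terms are split off each series. The constants cancel by [(p+2)/(p+1) = 1/(p+1) + 1]; in
   degree one the Bessel terms are both [1/(p+1)] and the two [4 * c] cancel. *)
rewrite (PSeries_decr_1 _ _ H0), (PSeries_decr_1 _ _ H1).
rewrite (PSeries_decr_1 _ _ K0), (PSeries_decr_1 _ _ K1).
change (PS_decr_1 (bessel_coef p) 0%nat) with (bessel_coef p 1).
change (PS_decr_1 (bessel_coef (p + 1)) 0%nat) with (bessel_coef (p + 1) 1).
rewrite !(bessel_coef_S _ 0), !bessel_coef_0 by lra. simpl INR.
field. lra.
Qed.

Lemma nbesselI_ge_1 (q x : R) : -1 < q -> 1 <= nbesselI q x.
Proof.
intros Hq. rewrite nbesselI_PSeries, <- (bessel_coef_0 q Hq).
rewrite <- (Rmult_1_r (bessel_coef q 0)).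
apply (PSeries_ge_term _ 0).
- intros n. left. now apply bessel_coef_pos.
- pose proof (pow2_ge_0 x). lra.
- now apply CV_radius_bessel_coef.
Qed.

(** * Signs of the gap coefficients *)

Lemma gap_coef_alpha_neg (p : R) (n : nat) : -1 < p -> gap_coef p 0 n < 0.
Proof.
intros Hp. pose proof (pos_INR n). rewrite gap_coef_eq by exact Hp.
assert (0 < bessel_coef p (S n) / (p + 2 + INR n))
  by (apply Rdiv_lt_0_compat; [now apply bessel_coef_pos | lra]).
assert (0 < (INR n + 1) / ((INR n + 2) * (p + 3 + INR n)))
  by (apply Rdiv_lt_0_compat; nra).
nra.
Qed.

(** This [c] makes the bracket of [gap_coef_eq] vanish at [n = 0], whence the factor [INR n]. *)
Lemma gap_coef_beta (p : R) (n : nat) : -1 < p ->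
  gap_coef p (1 / (8 * (p + 1) * (p + 3))) n
  = bessel_coef p (S n) / (p + 2 + INR n)
    * (INR n * (INR n - 1 - p) / (2 * (p + 3) * (INR n + 2) * (p + 3 + INR n))).
Proof.
intros Hp. pose proof (pos_INR n). rewrite gap_coef_eq by exact Hp. field. lra.
Qed.

Lemma gap_coef_beta_ge_0 (p : R) (n : nat) : -1 < p <= 0 ->
  0 <= gap_coef p (1 / (8 * (p + 1) * (p + 3))) n.
Proof.
intros Hp. pose proof (pos_INR n). rewrite gap_coef_beta by lra.
apply Rmult_le_pos; [left; apply Rdiv_lt_0_compat; [apply bessel_coef_pos; lra | lra]|].
apply Rdiv_le_0_compat.
(* From index 1 on, the factor [INR n - 1 - p] is at least [- p]; here [p <= 0] enters. *)
- destruct n as [|n]; [simpl; lra|]. rewrite S_INR. pose proof (pos_INR n). nra.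
- repeat apply Rmult_lt_0_compat; lra.
Qed.

(** Index 2 is the first that is positive for every such [p]: index 0 gives zero, and so does index
    1 when [p = 0]. *)
Lemma gap_coef_beta_2_pos (p : R) : -1 < p <= 0 ->
  0 < gap_coef p (1 / (8 * (p + 1) * (p + 3))) 2.
Proof.
intros Hp. rewrite gap_coef_beta by lra. simpl INR.
apply Rmult_lt_0_compat; apply Rdiv_lt_0_compat; try apply bessel_coef_pos; try lra.
repeat apply Rmult_lt_0_compat; lra.
Qed.

Lemma gap_coef_eventually_pos (p c : R) : -1 < p -> 0 < c ->
  exists N, forall n, (N <= n)%nat -> 0 < gap_coef p c n.
Proof.
intros Hp Hc.
assert (Hd : 0 < 4 * c * (p + 1)) by (apply Rmult_lt_0_compat; lra).
(* The subtracted fraction is below [1 / (p + 3 + INR n)], hence below [4 * c * (p + 1)] once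
   [INR n] exceeds the inverse of the latter. *)
destruct (INR_unbounded (/ (4 * c * (p + 1)))) as [N HN].
exists N. intros n Hn. apply le_INR in Hn. pose proof (pos_INR n).
rewrite gap_coef_eq by exact Hp.
apply Rmult_lt_0_compat;
  [apply Rdiv_lt_0_compat; [now apply bessel_coef_pos | lra]|].
set (d := 4 * c * (p + 1)) in *. clearbody d.
apply Rlt_0_minus.
apply Rmult_lt_reg_r with ((INR n + 2) * (p + 3 + INR n)); [nra|].
unfold Rdiv. rewrite Rmult_assoc, Rinv_l, Rmult_1_r by nra.
assert (1 < d * (p + 3 + INR n)).
{ apply Rmult_lt_reg_l with (/ d); [now apply Rinv_0_lt_compat|].
  rewrite <- Rmult_assoc, Rinv_l by lra. lra. }
nra.
Qed.

Lemma gap_coef_lt_beta_0_neg (p b : R) : -1 < p -> b < 1 / (8 * (p + 1) * (p + 3)) ->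
  gap_coef p b 0 < 0.
Proof.
intros Hp Hb. rewrite gap_coef_eq by exact Hp. simpl INR.
assert (0 < bessel_coef p 1 / (p + 2 + 0))
  by (apply Rdiv_lt_0_compat; [now apply bessel_coef_pos | lra]).
assert (4 * b * (p + 1) < (0 + 1) / ((0 + 2) * (p + 3 + 0))).
{ replace ((0 + 1) / ((0 + 2) * (p + 3 + 0)))
    with (4 * (1 / (8 * (p + 1) * (p + 3))) * (p + 1)) by (field; lra).
  apply Rmult_lt_compat_r; lra. }
nra.
Qed.

(** * From the gap series back to the quotient *)

Lemma quot_compare_1 (p c x : R) : -1 < p -> 0 < x -> 0 < quot_den p c x ->
  (quot p c x < 1 <-> PSeries (gap_coef p c) (x ^ 2 / 4) < 0) /\
  (1 < quot p c x <-> 0 < PSeries (gap_coef p c) (x ^ 2 / 4)).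
Proof.
intros Hp Hx Hden. pose proof (quot_gap p c x Hp) as H.
assert (Hv : 0 < (x ^ 2 / 4) ^ 2) by (apply pow_lt; pose proof (pow_lt x 2 Hx); lra).
unfold quot. rewrite <- Rdiv_lt_1, <- Rlt_div_r, Rmult_1_l by exact Hden.
set (S := PSeries _ _) in *. set (v := (x ^ 2 / 4) ^ 2) in *.
set (A := _ * nbesselI (p + 1) x) in *. clearbody S v A.
split; split; intros; nra.
Qed.

(** The hypothesis admits a negative [c] for small [x], as constants below [beta] require. *)
Lemma quot_den_pos (p c x : R) : -1 < p -> - (1 / (p + 1)) <= c * x ^ 2 ->
  0 < quot_den p c x.
Proof.
intros Hp Hc. pose proof (nbesselI_ge_1 p x Hp). unfold quot_den. lra.
Qed.

Lemma sqr_sqrt_quarter (u : R) : 0 < u -> (2 * sqrt u) ^ 2 / 4 = u.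
Proof.
intros Hu. rewrite Rpow_mult_distr, pow2_sqrt by lra. field.
Qed.

Theorem theorem2 (p : R) (hp : -1 < p <= 0) :
  let alpha := 0 in
  let beta := 1 / (8 * (p + 1) * (p + 3)) in
  (forall x : R, 0 < x -> quot p alpha x < 1 < quot p beta x) /\
  (forall a : R, alpha < a ->
     exists x : R, 0 < x /\ quot_den p a x <> 0 /\ ~ (quot p a x < 1)) /\
  (forall b : R, b < beta ->
     exists x : R, 0 < x /\ quot_den p b x <> 0 /\ ~ (1 < quot p b x)).
Proof.
intros alpha beta.
assert (Hp : -1 < p) by lra.
assert (Hip : 0 < 1 / (p + 1)) by (apply Rdiv_lt_0_compat; lra).
assert (Hbeta : 0 < beta).
{ apply Rdiv_lt_0_compat; [lra|]. repeat apply Rmult_lt_0_compat; lra. }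
assert (Hden : forall c x, 0 <= c -> 0 < quot_den p c x).
{ intros c x Hc. apply quot_den_pos; [exact Hp|]. pose proof (pow2_ge_0 x). nra. }
repeat split.
- apply quot_compare_1; [exact Hp | exact H | apply Hden; unfold alpha; lra |].
  unfold alpha. set (u := x ^ 2 / 4).
  assert (Hu : 0 < u) by (unfold u; pose proof (pow_lt x 2 H); lra).
  (* The negated series has positive coefficients, so it is at least its constant term. *)
  assert (Hge := PSeries_ge_term (PS_scal (-1) (gap_coef p 0)) 0 u).
  rewrite PSeries_scal in Hge.
  pose proof (gap_coef_alpha_neg p 0 Hp).
  enough (PS_scal (-1) (gap_coef p 0) 0%nat * u ^ 0 <= -1 * PSeries (gap_coef p 0) u)
    by (unfold PS_scal, scal in *; simpl in *; unfold mult in *; simpl in *; lra).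
  apply Hge; [|lra|].
  + intros n. pose proof (gap_coef_alpha_neg p n Hp).
    unfold PS_scal, scal; simpl. unfold mult; simpl. lra.
  + rewrite CV_radius_scal by lra. now apply CV_radius_gap_coef.
- apply quot_compare_1; [exact Hp | exact H | apply Hden; lra |].
  assert (Hu : 0 < x ^ 2 / 4) by (pose proof (pow_lt x 2 H); lra).
  apply Rlt_le_trans with (gap_coef p beta 2 * (x ^ 2 / 4) ^ 2).
  + apply Rmult_lt_0_compat; [now apply gap_coef_beta_2_pos | now apply pow_lt].
  + apply PSeries_ge_term; [intros n; now apply gap_coef_beta_ge_0 | lra |].
    now apply CV_radius_gap_coef.
- intros a Ha. unfold alpha in Ha.
  destruct (gap_coef_eventually_pos p a Hp Ha) as [N HN].
  destruct (PSeries_eventually_pos (gap_coef p a) N HN) as (u & Hu & HE).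
  { now apply CV_radius_gap_coef. }
  assert (Hx : 0 < 2 * sqrt u) by (pose proof (sqrt_lt_R0 u Hu); lra).
  (* A positive denominator makes the failure genuine, not an effect of division by zero. *)
  assert (Hd := Hden a (2 * sqrt u) ltac:(lra)).
  exists (2 * sqrt u). split; [exact Hx|]. split; [lra|].
  rewrite (proj1 (quot_compare_1 p a _ Hp Hx Hd)), sqr_sqrt_quarter by exact Hu. lra.
- intros b Hb.
  assert (H0 := gap_coef_lt_beta_0_neg p b Hp Hb).
  assert (Hcont : continuity_pt (PSeries (gap_coef p b)) 0).
  { apply PSeries_continuity. rewrite CV_radius_gap_coef by exact Hp. exact I. }
  (* The series equals [gap_coef p b 0 < 0] at the origin; with this tolerance it stays negative
     within [delta]. *)
  destruct (Hcont (- gap_coef p b 0)) as (delta & Hdelta & Hlt); [lra|].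
  (* The second bound gives [4 * Rabs b * u <= 1 / (p + 1)], which keeps the denominator positive
     even for negative [b]. *)
  set (u := Rmin (delta / 2) (1 / (p + 1) / (4 * (Rabs b + 1)))).
  pose proof (Rabs_pos b) as Hab.
  assert (Hr : 0 < 1 / (p + 1) / (4 * (Rabs b + 1))) by (apply Rdiv_lt_0_compat; lra).
  assert (Hu : 0 < u) by (apply Rmin_glb_lt; lra).
  assert (Hu1 : u <= delta / 2) by apply Rmin_l.
  assert (Hu2 : u <= 1 / (p + 1) / (4 * (Rabs b + 1))) by apply Rmin_r.
  assert (Hx : 0 < 2 * sqrt u) by (pose proof (sqrt_lt_R0 u Hu); lra).
  assert (Hd : 0 < quot_den p b (2 * sqrt u)).
  { apply quot_den_pos; [exact Hp|].
    pose proof (sqr_sqrt_quarter u Hu) as Hs.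
    replace ((2 * sqrt u) ^ 2) with (4 * u) by lra.
    apply (Rmult_le_compat_r (4 * (Rabs b + 1))) in Hu2; [|lra].
    unfold Rdiv at 1 in Hu2. rewrite Rmult_assoc, Rinv_l, Rmult_1_r in Hu2 by lra.
    pose proof (Rle_abs (- b)) as Hn. rewrite Rabs_Ropp in Hn. nra. }
  exists (2 * sqrt u). split; [exact Hx|]. split; [lra|].
  rewrite (proj2 (quot_compare_1 p b _ Hp Hx Hd)), sqr_sqrt_quarter by exact Hu.
  assert (Hlt' := Hlt u). simpl in Hlt'. unfold Rdist in Hlt'.
  rewrite PSeries_0 in Hlt'.
  assert (H1 : Rabs (PSeries (gap_coef p b) u - gap_coef p b 0) < - gap_coef p b 0).
  { apply Hlt'. split; [split; [exact I | lra]|].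
    rewrite Rabs_pos_eq; lra. }
  apply Rabs_def2 in H1. lra.
Qed.
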